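(* Let $Q$ be a network, $\alpha>0$, and $I\subseteq Q$ an independent set of cardinality $l$. Let $W$ be the set of points of $Q$ at distance at most $\alpha/2$ from $I$ and $W^c=Q\setminus W$. Then the value of the continuous patrolling game satisfies $$V\le\frac{\alpha}{\lambda(W^c)+l\alpha},$$ and the Attacker can ensure this bound by adopting the independent attack strategy. If $\lambda(W^c)=0$ then $V\le1/l$. Furthermore, if $I$ is the set of leaf nodes and all leaf arcs have length exceeding $\alpha/2$, then $$V\le\frac{\alpha}{\mu+l\alpha/2}.$$
   Context: A network $Q$ is a finite connected graph, possibly with multiple arcs and loops and with no node of degree two, and it is not a line segment. Arcs are open intervals of positive length. $\lambda$ is the length measure, $\mu=\lambda(Q)$, and $d$ is the shortest-path metric. A leaf node has degree $1$ and its arc is a leaf arc. The game is as follows. The Patroller picks a patrol $S:[0,\infty)\to Q$ with $d(S(t),S(t'))\le|t-t'|$. The Attacker picks $x\in Q$ and a start time $\tau\ge0$. The Patroller wins (payoff $1$) iff $x\in S([\tau,\tau+\alpha])$. $V$ is the value with mixed strategies. It is assumed that $0<\alpha<\bar\mu$, the minimum length of a closed path covering $Q$. A set $I$ is independent if any two of its points are at distance at least $\alpha$. The independent attack strategy uses $p=l\alpha/(\lambda(W^c)+l\alpha)$: - with probability $p$, it attacks an equiprobably chosen element of $I$ at a start time uniform in $[0,\alpha]$; - with probability $1-p$, it attacks a point chosen uniformly (according to $\lambda$) in $W^c$ at start time $\alpha/2$. *)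

(* Defs.v *)
From HB Require Import structures.
From mathcomp Require Import all_boot all_order all_algebra finmap.
From mathcomp Require Import all_classical all_reals all_analysis measurable_realfun.
From mathcomp Require Import ring lra.
Set Implicit Arguments.
Unset Strict Implicit.
Unset Printing Implicit Defensive.
Import Order.TTheory GRing.Theory Num.Theory.
Import numFieldTopology.Exports numFieldNormedType.Exports.
Local Open Scope classical_set_scope.
Local Open Scope ring_scope.

Section multigraph.
Context (node arc : finType) (src tgt : arc -> node).

(* A loop counts twice. *)
Definition mdegree (v : node) : nat :=
  (#|[pred e | src e == v]| + #|[pred e | tgt e == v]|)%N.

Definition madj : rel node := fun u v =>
  [exists e, ((src e == u) && (tgt e == v)) || ((src e == v) && (tgt e == u))].

End multigraph.

(* Each arc carries an arbitrary orientation, used only to parametrize it.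
   A connected graph with two nodes and a single arc is a line segment. *)
Record network (R : realType) := Network {
  nodes : finType;
  arcs : finType;
  src : arcs -> nodes;
  tgt : arcs -> nodes;
  len : arcs -> R;
  len_gt0 : forall e, 0 < len e;
  node_gt0 : (0 < #|nodes|)%N;
  network_connected : forall u v, connect (madj src tgt) u v;
  mdegree_neq2 : forall v, mdegree src tgt v != 2%N;
  not_segment : ~~ ((#|nodes| == 2%N) && (#|arcs| == 1%N))
}.

Definition degree (R : realType) (Q : network R) (v : nodes Q) : nat :=
  mdegree (@src _ Q) (@tgt _ Q) v.

(* The points of Q: its nodes, and for each arc e the open interval ]0, len e[. *)
Definition netpoint (R : realType) (Q : network R) : Type :=
  (nodes Q + {p : arcs Q * R | 0 < p.2 < len p.1})%type.

HB.instance Definition _ (R : realType) (Q : network R) :=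
  Choice.copy (netpoint Q) (nodes Q + {p : arcs Q * R | 0 < p.2 < len p.1})%type.
HB.instance Definition _ (R : realType) (Q : network R) :=
  isPointed.Build (netpoint Q) (inl (enum_val (Ordinal (node_gt0 Q)))).

Section paths.
Context (R : realType) (Q : network R).

Definition node_point (v : nodes Q) : netpoint Q := inl v.

(* The closed arc e, parametrized by [0, len e] (constant outside). *)
Definition arc_point (e : arcs Q) (t : R) : netpoint Q :=
  match insub (e, t) with
  | Some p => inr p
  | None => node_point (if t <= 0 then src e else tgt e)
  end.

(* A segment ((e, s), t) is traversed in arc e from parameter s to t. *)
Fixpoint is_path (x : netpoint Q) (p : seq (arcs Q * R * R)) (y : netpoint Q) : Prop :=
  match p with
  | [::] => x = y
  | (e, s, t) :: p' =>
    [/\ 0 <= s <= len e, 0 <= t <= len e, x = arc_point e s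
      & is_path (arc_point e t) p' y]
  end.

Definition path_length (p : seq (arcs Q * R * R)) : R :=
  \sum_(z <- p) `|z.2 - z.1.2|.

(* Distances and tour lengths are infima over paths made of finitely many
   segments; these infima agree with those over all continuous paths. *)
Definition path_dist (x y : netpoint Q) : R :=
  inf [set path_length p | p in [set p | is_path x p y]].

Definition covering (p : seq (arcs Q * R * R)) : Prop :=
  forall y, exists e s t u,
    [/\ (e, s, t) \in p, Num.min s t <= u <= Num.max s t & y = arc_point e u].

Definition min_tour_length : R :=
  inf [set path_length p | p in [set p | covering p /\ exists x, is_path x p x]].

Lemma arc_point_le0 e t : t <= 0 -> arc_point e t = node_point (src e).
Proof.
move=> t0; rewrite /arc_point insubF/= ?t0//.
by apply/negbTE; rewrite negb_and -leNgt t0.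
Qed.

Lemma arc_point_ge e t : len e <= t -> arc_point e t = node_point (tgt e).
Proof.
move=> t1; rewrite /arc_point insubF/=; last first.
  by apply/negbTE; rewrite negb_and -!leNgt t1 orbT.
by rewrite leNgt (lt_le_trans (len_gt0 e) t1).
Qed.

Lemma arc_point_inner (p : {p : arcs Q * R | 0 < p.2 < len p.1}) :
  inr p = arc_point (val p).1 (val p).2.
Proof.
case: p => -[e t] /= h; rewrite /arc_point insubT.
by congr inr; apply: val_inj.
Qed.

Lemma pointP x : (exists v, x = node_point v) \/
  exists e t, 0 < t < len e /\ x = arc_point e t.
Proof.
case: x => [v|p]; first by left; exists v.
by right; exists (val p).1, (val p).2; split; [exact: (valP p)|exact: arc_point_inner].
Qed.

Lemma path_length_ge0 p : 0 <= path_length p.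
Proof. exact: sumr_ge0. Qed.

Lemma path_length_cat p q : path_length (p ++ q) = path_length p + path_length q.
Proof. by rewrite /path_length big_cat. Qed.

Lemma is_path_cat x y z p q : is_path x p y -> is_path y q z -> is_path x (p ++ q) z.
Proof.
elim: p x => [|[[e s] t] p IH] x /=; first by move=> ->.
by case=> hs ht -> /IH h /h.
Qed.

Definition path_rev (p : seq (arcs Q * R * R)) := rev [seq (z.1.1, z.2, z.1.2) | z <- p].

Lemma is_path_rev x y p : is_path x p y -> is_path y (path_rev p) x.
Proof.
elim: p x => [|[[e s] t] p IH] x /=; first by move=> ->.
case=> hs ht -> /IH h; rewrite /path_rev /= rev_cons -cats1.
exact: is_path_cat h _.
Qed.

Lemma path_length_rev p : path_length (path_rev p) = path_length p.
Proof.
rewrite /path_length /path_rev (perm_big _ (permEl (perm_rev _))) big_map /=.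
by apply: eq_bigr => z _; rewrite distrC.
Qed.

Lemma path_existsC x y : (exists p, is_path x p y) -> exists p, is_path y p x.
Proof. by case=> p /is_path_rev; exists (path_rev p). Qed.

Lemma path_exists_trans y x z : (exists p, is_path x p y) ->
  (exists p, is_path y p z) -> exists p, is_path x p z.
Proof. by case=> p hp [q hq]; exists (p ++ q); exact: is_path_cat hp hq. Qed.

Lemma path_exists_arc e : exists p, is_path (node_point (src e)) p (node_point (tgt e)).
Proof.
have l0 := len_gt0 e.
exists [:: (e, 0, len e)] => /=; split; rewrite ?lexx ?ltW//.
- by rewrite arc_point_le0.
- by rewrite arc_point_ge.
Qed.

Lemma path_exists_node u v : exists p, is_path (node_point u) p (node_point v).
Proof.
have /connectP[s us ->] := network_connected u v.
elim: s u us => [|w s IH] u /=; first by move=> _; exists [::].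
case/andP => /existsP[e he] /IH; apply: path_exists_trans.
by case/orP: he => /andP[/eqP <- /eqP <-]; [|apply: path_existsC];
  exact: path_exists_arc.
Qed.

Lemma path_exists_src x : exists v p, is_path (node_point v) p x.
Proof.
case: (pointP x) => [[v ->]|[e [t [/andP[t0 t1] ->]]]].
  by exists v, [::].
have l0 := len_gt0 e.
exists (src e), [:: (e, 0, t)] => /=; split; rewrite ?lexx ?ltW//.
by rewrite arc_point_le0.
Qed.

Lemma path_exists x y : exists p, is_path x p y.
Proof.
have [u hu] := path_exists_src x; have [v hv] := path_exists_src y.
apply: path_exists_trans hv; apply: path_exists_trans (path_exists_node u v).
exact: path_existsC.
Qed.

Lemma has_inf_path x y :
  has_inf [set path_length p | p in [set p | is_path x p y]].
Proof.
split; first by have [p hp] := path_exists x y; exists (path_length p), p.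
by exists 0 => _ [p _ <-]; exact: path_length_ge0.
Qed.

Lemma path_dist_le x y p : is_path x p y -> path_dist x y <= path_length p.
Proof. by move=> hp; apply: (ge_inf (has_inf_path x y).2); exists p. Qed.

Lemma le_path_dist x y c :
  (forall p, is_path x p y -> c <= path_length p) -> c <= path_dist x y.
Proof.
move=> h; apply: (lb_le_inf (has_inf_path x y).1).
by move=> _ [p hp <-]; exact: h.
Qed.

Lemma path_dist_ge0 x y : 0 <= path_dist x y.
Proof. by apply: le_path_dist => p _; exact: path_length_ge0. Qed.

Lemma path_distxx x : path_dist x x = 0.
Proof.
apply/le_anti; rewrite path_dist_ge0 andbT.
have /path_dist_le : is_path x [::] x by [].
by rewrite /path_length big_nil.
Qed.

Lemma path_dist_sym x y : path_dist x y = path_dist y x.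
Proof.
suff h u v : path_dist u v <= path_dist v u by apply/le_anti; rewrite !h.
apply: le_path_dist => p hp; rewrite -(path_length_rev p).
exact/path_dist_le/is_path_rev.
Qed.

Lemma path_dist_triangle y x z : path_dist x z <= path_dist x y + path_dist y z.
Proof.
rewrite -lerBlDl; apply: le_path_dist => q hq.
rewrite lerBlDl addrC -lerBlDl; apply: le_path_dist => p hp.
rewrite lerBlDl addrC -path_length_cat; exact/path_dist_le/(is_path_cat hp hq).
Qed.

Lemma lipschitz_path_dist (f : netpoint Q -> R) :
  (forall e s t, 0 <= s <= len e -> 0 <= t <= len e ->
    `|f (arc_point e s) - f (arc_point e t)| <= `|t - s|) ->
  forall x y, `|f x - f y| <= path_dist x y.
Proof.
move=> lf x y; apply: le_path_dist => p.
elim: p x => [|[[e s] t] p IH] x /=.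
  by move=> ->; rewrite subrr normr0 /path_length big_nil.
case=> hs ht -> /IH h; rewrite /path_length big_cons /=.
rewrite -(subrK (f (arc_point e t)) (f (arc_point e s))) -addrA.
by apply: le_trans (ler_normD _ _) _; apply: lerD h; exact: lf.
Qed.

Lemma arc_point_val e t (h : 0 < t < len e) :
  arc_point e t = inr (exist (fun p : arcs Q * R => 0 < p.2 < len p.1) (e, t) h).
Proof. by rewrite arc_point_inner. Qed.

Lemma arc_pointE e t : 0 <= t <= len e ->
  [\/ t = 0 /\ arc_point e t = node_point (src e),
      t = len e /\ arc_point e t = node_point (tgt e) |
      exists h : 0 < t < len e,
       arc_point e t = inr (exist (fun p : arcs Q * R => 0 < p.2 < len p.1) (e, t) h)].
Proof.
rewrite !le_eqVlt eq_sym => /andP[/orP[/eqP ->|t0]].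
  by move=> _; apply: Or31; rewrite arc_point_le0.
case/orP => [/eqP ->|t1]; first by apply: Or32; rewrite arc_point_ge.
have h : 0 < t < len e by rewrite t0.
by apply: Or33; exists h; exact: arc_point_val.
Qed.

Let pos (a : R) : R := Num.max 0 a.

Let pos_lip a b : `|pos a - pos b| <= `|a - b|.
Proof.
rewrite /pos; case: (ltP 0 a) => ha; case: (ltP 0 b) => hb.
- by [].
- rewrite subr0 gtr0_norm// ger0_norm; lra.
- rewrite sub0r normrN gtr0_norm// ler0_norm; lra.
- by rewrite subrr normr0.
Qed.

Let norm_eqW (a b : R) : a = b -> `|a| <= `|b|. Proof. by move=> ->. Qed.

Let max_lip (a b c d e : R) : `|a - b| <= e -> `|c - d| <= e ->
  `|Num.max a c - Num.max b d| <= e.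
Proof.
rewrite !ler_norml => /andP[h1 h2] /andP[h3 h4].
by case: (ltP a c) => ?; case: (ltP b d) => ?; apply/andP; split; lra.
Qed.

Lemma path_dist_eq0_inner e s y : 0 < s < len e ->
  path_dist (arc_point e s) y = 0 -> arc_point e s = y.
Proof.
move=> hs d0; have /andP[s0 s1] := hs.
pose r := Num.min s (len e - s).
have r0 : 0 < r by rewrite lt_min s0 subr_gt0.
have rs : r <= s by rewrite ge_min lexx.
have rl : r <= len e - s by rewrite ge_min lexx orbT.
pose f (z : netpoint Q) : R := match z with
  | inl _ => 0
  | inr p => if (val p).1 == e then pos (r - `|(val p).2 - s|) else 0
  end.
have fE t : 0 <= t <= len e -> f (arc_point e t) = pos (r - `|t - s|).
  move=> ht; case: (arc_pointE ht) => [[-> ->]|[-> ->]|[h ->]] /=.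
  - rewrite sub0r normrN gtr0_norm// /pos; symmetry; apply/max_idPl; lra.
  - rewrite gtr0_norm ?subr_gt0// /pos; symmetry; apply/max_idPl; lra.
  - by rewrite eqxx.
have fE' e' t : e' != e -> 0 <= t <= len e' -> f (arc_point e' t) = 0.
  move=> ne ht; case: (arc_pointE ht) => [[_ ->]|[_ ->]|[h ->]] //=.
  by rewrite (negbTE ne).
have lf := @lipschitz_path_dist f _ (arc_point e s) y.
have {lf} : `|f (arc_point e s) - f y| <= 0.
  rewrite -d0; apply: lf => e' u t hu ht.
  have [ee|ne] := eqVneq e' e; last by rewrite !fE'// subrr normr0.
  subst e'; rewrite !fE//; apply: le_trans (pos_lip _ _) _.
  have -> : r - `|u - s| - (r - `|t - s|) = `|t - s| - `|u - s| by ring.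
  apply: le_trans (ler_dist_dist _ _) _.
  by apply: norm_eqW; ring.
rewrite normr_le0 subr_eq0 fE ?(ltW s0) ?(ltW s1)// subrr normr0 subr0.
rewrite /pos (max_idPr (ltW r0)).
case: y {d0} => [v|[[e' t] ht]] /=; first by rewrite gt_eqF.
have [ee|_] := eqVneq e' e; last by rewrite gt_eqF.
subst e'; rewrite /pos; case: (ltP 0 (r - `|t - s|)) => _; last by rewrite gt_eqF.
move/eqP=> h; have /eqP : `|t - s| = 0 by lra.
rewrite normr_eq0 subr_eq0 => /eqP ts.
by subst t; rewrite (arc_point_val ht).
Qed.

Lemma path_dist_eq0 x y : path_dist x y = 0 -> x = y.
Proof.
case: (pointP x) => [[v ->]|[e [s [hs ->]]]]; last exact: path_dist_eq0_inner.
case: (pointP y) => [[w ->]|[e [s [hs ->]]]]; last first.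
  by rewrite path_dist_sym => /(path_dist_eq0_inner hs).
move=> d0.
pose r : R := \big[Num.min/1]_(e : arcs Q) len e.
have r0 : 0 < r.
  by apply: (big_ind (fun a : R => 0 < a)) => // [a b a0 b0|e _];
    [rewrite lt_min a0|exact: len_gt0].
have rl (e : arcs Q) : r <= len e by exact: bigmin_le_cond.
pose g e t : R := Num.max (if src e == v then pos (r - t) else 0)
                    (if tgt e == v then pos (r - (len e - t)) else 0).
pose f (z : netpoint Q) : R := match z with
  | inl u => if u == v then r else 0
  | inr p => g (val p).1 (val p).2
  end.
have fE e t : 0 <= t <= len e -> f (arc_point e t) = g e t.
  move=> ht; have le := rl e; case: (arc_pointE ht) => [[-> ->]|[-> ->]|[h ->]] //=;
  rewrite /g.
  - rewrite !subr0 (_ : pos (r - len e) = 0); last by apply/max_idPl; lra.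
    rewrite (_ : pos r = r); last exact/max_idPr/ltW.
    by rewrite if_same; symmetry; apply/max_idPl; case: ifP => // _; exact: ltW.
  - rewrite subrr subr0 (_ : pos (r - len e) = 0); last by apply/max_idPl; lra.
    rewrite (_ : pos r = r); last exact/max_idPr/ltW.
    by rewrite if_same; symmetry; apply/max_idPr; case: ifP => // _; exact: ltW.
have lf := @lipschitz_path_dist f _ (node_point v) (node_point w).
have {lf} : `|f (node_point v) - f (node_point w)| <= 0.
  rewrite -d0; apply: lf => e s t hs ht; rewrite !fE// /g.
  apply: max_lip.
  - case: ifP => _; last by rewrite subrr normr0.
    by apply: le_trans (pos_lip _ _) _; apply: norm_eqW; ring.
  - case: ifP => _; last by rewrite subrr normr0.
    apply: le_trans (pos_lip _ _) _; rewrite distrC.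
    by apply: norm_eqW; ring.
rewrite normr_le0 subr_eq0 /= eqxx.
by have [->//|_] := eqVneq w v; rewrite (gt_eqF r0).
Qed.

End paths.

(* Library metric structure: [mdist] on [netpoint Q] is the shortest-path metric. *)
HB.instance Definition _ (R : realType) (Q : network R) :=
  isMetric.Build R (netpoint Q) (@path_distxx R Q) (@path_dist_eq0 R Q)
    (@path_dist_sym R Q) (@path_dist_triangle R Q).

Section measurable_structure.
Context (R : realType) (Q : network R).

HB.instance Definition _ := @isMeasurable.Build (sigma_display (@open (netpoint Q)))
  (netpoint Q) <<s @open (netpoint Q) >> (@sigma_algebra0 _ setT _)
  (@sigma_algebraC _ _) (@sigma_algebra_bigcup _ setT _).

Lemma open_point_measurable (A : set (netpoint Q)) : open A -> measurable A.
Proof. exact: sub_sigma_algebra. Qed.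

Lemma mdistE (x y : netpoint Q) : mdist x y = path_dist x y.
Proof. by []. Qed.

Lemma arc_point_lipschitz (e : arcs Q) s t :
  mdist (arc_point e s) (arc_point e t) <= `|t - s|.
Proof.
have l0 := len_gt0 e.
pose c (t : R) := Num.max 0 (Num.min t (len e)).
have cE u : arc_point e u = arc_point e (c u).
  rewrite /c; case: (ltP u (len e)) => hu; last first.
    by rewrite (max_idPr (ltW l0)) !arc_point_ge.
  by case: (ltP 0 u) => // hu'; rewrite !arc_point_le0.
have cb u : 0 <= c u <= len e.
  rewrite /c; case: (ltP u (len e)) => hu; last by rewrite (max_idPr (ltW l0)) ltW/=.
  by case: (ltP 0 u) => hu'; apply/andP; split; lra.
have cl : `|c t - c s| <= `|t - s|.
  have := ler_norm (t - s); have := ler_norm (s - t); rewrite (distrC s t).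
  rewrite ler_norml /c; case: (ltP s (len e)) => h1; case: (ltP t (len e)) => h2;
    rewrite ?(max_idPr (ltW l0)) //; case: (ltP 0 s) => h3;
    case: (ltP 0 t) => h4 h5 h6;
    apply/andP; split; lra.
rewrite (cE s) (cE t) mdistE.
have /path_dist_le : is_path (arc_point e (c s)) [:: (e, c s, c t)] (arc_point e (c t)).
  by split.
by rewrite /path_length big_seq1 /= => /le_trans; apply.
Qed.

Lemma arc_point_continuous (e : arcs Q) : continuous (arc_point e : R -> netpoint Q).
Proof.
move=> t; apply/cvg_ballP => eps eps0; near=> s.
rewrite ballEmdist /=; apply: le_lt_trans (arc_point_lipschitz _ _ _) _.
near: s; apply: filterS (nbhsx_ballx t eps eps0) => s; rewrite -ball_normE /= distrC.
by [].
Unshelve. all: by end_near. Qed.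

Lemma measurable_arc_point (e : arcs Q) :
  measurable_fun setT (arc_point e : R -> netpoint Q).
Proof.
apply: (measurability (@open (netpoint Q))) => // _ [A oA <-]; rewrite setTI.
by apply: open_measurable; move/continuousP : (@arc_point_continuous e); apply.
Qed.

End measurable_structure.

Section measures.
Local Open Scope ereal_scope.
Context d (T : measurableType d) (R : realType).

Definition is_measure (f : set T -> \bar R) : Prop :=
  exists m : {measure set T -> \bar R}, f = m.

Lemma is_measure_sum J (s : seq J) (f : J -> set T -> \bar R) :
  (forall j, is_measure (f j)) -> is_measure (fun A => \sum_(j <- s) f j A).
Proof.
move=> mf; elim: s => [|j s [m hm]].
  by exists mzero; apply/funext => A; rewrite big_nil.
have [m' hm'] := mf j; exists (measure_add m' m); apply/funext => A.
by rewrite big_cons hm' (congr1 (fun h => h A) hm); apply/esym/measure_addE.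
Qed.

Lemma is_measure_add (f g : set T -> \bar R) :
  is_measure f -> is_measure g -> is_measure (fun A => f A + g A).
Proof.
move=> [m ->] [m' ->]; exists (measure_add m m'); apply/funext => A.
by apply/esym/measure_addE.
Qed.

Lemma is_measure_scale (c : R) (f : set T -> \bar R) : (0 <= c)%R ->
  is_measure f -> is_measure (fun A => c%:E * f A).
Proof. by move=> c0 [m ->]; exists (mscale (NngNum c0) m). Qed.

Lemma is_measure_pushforward d' (T' : measurableType d') (g : T' -> T)
    (m : {measure set T' -> \bar R}) : measurable_fun setT g ->
  is_measure (fun A => m (g @^-1` A)).
Proof.
move=> mg.
pose m' : {measure set T -> \bar R} := pushforward m g.
by exists (m' mg).
Qed.

Lemma is_measure0 f : is_measure f -> f set0 = 0.
Proof. by case=> m ->. Qed.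

Lemma is_measure_ge0 f A : is_measure f -> 0 <= f A.
Proof. by case=> m ->. Qed.

Lemma is_measure_semi_sigma_additive f : is_measure f -> semi_sigma_additive f.
Proof. by case=> m ->; exact: measure_semi_sigma_additive. Qed.

End measures.

Section length_measure.
Context (R : realType) (Q : network R).

Definition length_measure (A : set (netpoint Q)) : \bar R :=
  (\sum_(e : arcs Q)
    lebesgue_measure (arc_point e @^-1` A `&` `]0%R, len e[%classic))%E.

Lemma is_measure_length : is_measure length_measure.
Proof.
apply: is_measure_sum => e.
pose m := mrestr lebesgue_measure (measurable_itv `]0, len e[).
exact: (@is_measure_pushforward _ (netpoint Q) R _ _ _ m (@measurable_arc_point _ _ e)).
Qed.

HB.instance Definition _ := isMeasure.Build _ (netpoint Q) R length_measure
  (is_measure0 is_measure_length) (fun A => is_measure_ge0 A is_measure_length)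
  (is_measure_semi_sigma_additive is_measure_length).

End length_measure.

Record patrol (R : realType) (Q : network R) := Patrol {
  patrol_at :> R -> netpoint Q; (* only its values on [0, +oo[ are relevant *)
  patrol_lipschitz : forall t t', 0 <= t -> 0 <= t' ->
    mdist (patrol_at t) (patrol_at t') <= `|t - t'|
}.

Section game.
Context (R : realType) (Q : network R).

HB.instance Definition _ := gen_eqMixin (patrol Q).
HB.instance Definition _ := gen_choiceMixin (patrol Q).

Let stay (x : netpoint Q) (t t' : R) : 0 <= t -> 0 <= t' ->
  mdist (cst x t) (cst x t') <= `|t - t'|.
Proof. by move=> _ _; rewrite mdistxx. Qed.

HB.instance Definition _ := isPointed.Build (patrol Q) (Patrol (@stay point)).

(* Random patrols: the sigma-algebra generated by the positions S(t), t >= 0. *)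
Definition cylinder : set (set (patrol Q)) :=
  [set [set S : patrol Q | B (S t)] | t in [set t | 0 <= t] & B in measurable].

HB.instance Definition _ := @isMeasurable.Build (sigma_display cylinder)
  (patrol Q) <<s cylinder >> (@sigma_algebra0 _ setT _)
  (@sigma_algebraC _ _) (@sigma_algebra_bigcup _ setT _).

(* The attack (x, tau) is intercepted iff x lies in S([tau, tau + alpha]). *)
Definition intercepts (alpha : R) (S : patrol Q) (a : netpoint Q * R) : Prop :=
  exists t, a.2 <= t <= a.2 + alpha /\ S t = a.1.

(* Mixed attacks are probability measures on pairs (x, tau) with tau >= 0. *)
Definition is_mixed_attack
    (P : {measure set (netpoint Q * R) -> \bar R}) : Prop :=
  P setT = 1%E /\ P [set a | a.2 < 0] = 0%E.

(* The Patroller's maximin and the Attacker's minimax over mixed strategies;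
   the game has value V when both are equal to V. *)
Definition lower_value (alpha : R) : \bar R :=
  ereal_sup [set ereal_inf [set P [set S | intercepts alpha S a]
                           | a in [set a | 0 <= a.2]]
            | P in [set: probability (patrol Q) R]].

Definition upper_value (alpha : R) : \bar R :=
  ereal_inf [set ereal_sup [set P (intercepts alpha S) | S in [set: patrol Q]]
            | P in [set P | is_mixed_attack P]].

Definition is_value (alpha V : R) : Prop :=
  lower_value alpha = V%:E /\ upper_value alpha = V%:E.

End game.

Section independent_attack.
Context (R : realType) (Q : network R) (alpha : R) (alpha_gt0 : 0 < alpha).
Variable I : {fset netpoint Q}.

Definition independent : Prop :=
  {in I &, forall x y, x != y -> alpha <= mdist x y}.

Definition nearby : set (netpoint Q) :=
  [set y | exists2 x, x \in I & mdist y x <= alpha / 2].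

Definition far_length : R := fine (length_measure (~` nearby)).

Definition independent_attack_weight : R :=
  #|` I|%:R * alpha / (far_length + #|` I|%:R * alpha).

Local Notation p := independent_attack_weight.

(* When I is empty (resp. the complement of [nearby] is null), p = 0
   (resp. p = 1), and the meaningless first (resp. second) term vanishes. *)
Definition independent_attack (A : set (netpoint Q * R)) : \bar R :=
  ((p / #|` I|%:R)%:E *
     \sum_(x <- I) uniform_prob alpha_gt0 [set tau | A (x, tau)]
   + ((1 - p) / far_length)%:E *
     length_measure ([set x | A (x, (alpha / 2)%R)] `&` ~` nearby))%E.

Lemma open_far : open (~` nearby).
Proof.
rewrite openE => y yfar; rewrite /interior.
have [e e0 he] : exists2 e : R, 0 < e &
    forall x, x \in I -> alpha / 2 + e <= mdist y x.
  pose e := \big[Num.min/1]_(x <- I) (mdist y x - alpha / 2).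
  exists e => [|x xI].
    rewrite /e big_seq; apply: (big_ind (fun a : R => 0 < a)) => // [a b a0 b0|x xI].
      by rewrite lt_min a0.
    by rewrite subr_gt0 ltNge; apply/negP => h; apply: yfar; exists x.
  by rewrite -lerBrDl /e; apply: (@bigmin_inf_seq _ _ _ _ _ x).
apply/nbhs_ballP; exists e => // z /=; rewrite ballEmdist /= => yz [x xI zx].
have := he x xI; have := metric_triangle y z x; lra.
Qed.

Lemma far_length_ge0 : 0 <= far_length.
Proof. exact/fine_ge0/measure_ge0. Qed.

Lemma is_measure_independent_attack : is_measure independent_attack.
Proof.
have f0 := far_length_ge0.
have l0 : 0 <= #|` I|%:R * alpha by rewrite mulr_ge0// ltW.
have p0 : 0 <= p by rewrite divr_ge0 ?addr_ge0.
have p1 : 0 <= 1 - p.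
  rewrite subr_ge0 /p; have [->|h] := eqVneq (far_length + #|` I|%:R * alpha) 0.
    by rewrite invr0 mulr0.
  by rewrite ler_pdivrMr ?mul1r ?lerDr// lt_neqAle eq_sym h addr_ge0.
apply: is_measure_add; apply: is_measure_scale; try exact: divr_ge0.
  apply: (@is_measure_sum _ (netpoint Q * R)%type R _ I
    (fun x A => uniform_prob alpha_gt0 [set tau | A (x, tau)])) => x.
  apply: (@is_measure_pushforward _ (netpoint Q * R)%type R _ _
    (fun tau : measurableTypeR R => (x, tau : R)) (uniform_prob alpha_gt0)).
  exact: measurable_pair1.
have mfar : measurable (~` nearby) by apply: open_point_measurable; exact: open_far.
pose m := mrestr (@length_measure R Q) mfar.
apply: (@is_measure_pushforward _ (netpoint Q * R)%type R _ _
  (fun x : netpoint Q => (x, alpha / 2)) m).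
exact: measurable_pair2.
Qed.

HB.instance Definition _ :=
  isMeasure.Build _ (netpoint Q * R)%type R independent_attack
  (is_measure0 is_measure_independent_attack)
  (fun A => is_measure_ge0 A is_measure_independent_attack)
  (is_measure_semi_sigma_additive is_measure_independent_attack).

End independent_attack.

Definition is_leaf (R : realType) (Q : network R) (v : nodes Q) : bool :=
  degree v == 1%N.

Definition leaf_arc (R : realType) (Q : network R) (e : arcs Q) : bool :=
  is_leaf (src e) || is_leaf (tgt e).

(* Main.v *)
(* Consider the start times tau in [0, alpha]. Points of I are
   alpha apart, so up to a null set of tau the window [tau, tau + alpha] of a patrol S
   meets at most one point of I. The set of tau whose window meets no point of I is
   therefore disjoint from the others, and by the 1-Lipschitz property its measure
   bounds the length of W^c swept during [alpha/2, 3 alpha/2]: if S t lies outside W,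
   then the window centred at t misses I. Hence the lengths of these sets of tau, plus
   the swept length of W^c, add up to at most alpha, which is the bound. For leaves,
   each ball of radius alpha/2 is a piece of a leaf arc, so has length at most alpha/2. *)

Require Import Defs.
From mathcomp Require Import all_boot all_order all_algebra finmap.
From mathcomp Require Import all_classical all_reals all_analysis.
From mathcomp Require Import measurable_realfun ring lra.
Import Order.TTheory GRing.Theory Num.Theory.
Import numFieldTopology.Exports numFieldNormedType.Exports.
Local Open Scope classical_set_scope.
Local Open Scope ring_scope.

(** * Measure estimates on the real line and for almost disjoint unions *)

Lemma lebesgue_measure_diam (R : realType) (E : set R) (c : R) : 0 <= c ->
  {in E &, forall x y, `|x - y| <= c} -> (lebesgue_measure E <= c%:E)%E.
Proof.
move=> c0 Ec; have [->|/set0P[x0 Ex0]] := eqVneq E set0.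
  by rewrite measure0 lee_fin.
have hE : has_inf E.
  split; first by exists x0.
  exists (x0 - c) => y Ey.
  have := Ec x0 y (mem_set Ex0) (mem_set Ey); rewrite ler_norml => /andP[_]; lra.
have EI : E `<=` `[inf E, inf E + c].
  move=> y Ey; rewrite /= in_itv /= (ge_inf hE.2) //= -lerBlDr.
  apply: lb_le_inf => [|z Ez]; first by exists x0.
  have := Ec y z (mem_set Ey) (mem_set Ez); rewrite ler_norml => /andP[_]; lra.
apply: (@le_trans _ _ (lebesgue_measure (`[inf E, inf E + c]%classic : set R))).
  exact: le_outer_measure.
rewrite lebesgue_measure_itv /= lte_fin; case: ifP => _; last by rewrite lee_fin.
by rewrite -EFinD addrAC subrr add0r.
Qed.

Lemma lebesgue_measure_lipschitz_image (R : realType) (f : R -> R) (A : set R) :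
  (forall s t, `|f s - f t| <= `|s - t|) ->
  (lebesgue_measure (f @` A) <= lebesgue_measure A)%E.
Proof.
move=> lf.
(* lebesgue_measure is this outer measure, so it makes sense on any set. *)
suff: ((wlength idfun)^*%mu (f @` A) <= (wlength idfun)^*%mu A)%E by [].
rewrite [leRHS]outer_measure_open_itv_cover; apply: le_ereal_inf_tmp => _ [F [Fitv AF] <-].
apply: (@le_trans _ _ (\sum_(k <oo) lebesgue_measure (f @` F k))%E).
  apply: le_trans (outer_measure_sigma_subadditive lebesgue_measure _).
  by apply: le_outer_measure => _ [t /AF[k _ Fkt] <-]; exists k => //; exists t.
apply: lee_nneseries => // k _; have [[a b] /= ->] := Fitv k.
have [ba|ab] := leP b a.
  by rewrite (set_itv_ge _) ?bnd_simp -?leNgt// image_set0 measure0.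
rewrite wlength_itv /= lte_fin ab -EFinD.
apply: lebesgue_measure_diam; first by rewrite subr_ge0 ltW.
move=> _ _ /set_mem[s + <-] /set_mem[t + <-]; rewrite /= !in_itv /= => /andP[? ?] /andP[? ?].
by apply: le_trans (lf _ _) _; rewrite ler_norml; apply/andP; split; lra.
Qed.

(** Induction on [s]: the head meets the union of the tail in a finite union of null sets. *)
Lemma measure_bigsetU_null d (T : measurableType d) (R : realType)
    (m : {measure set T -> \bar R}) (J : eqType) (s : seq J) (F : J -> set T) :
  uniq s -> (forall j, measurable (F j)) ->
  (forall i j, i \in s -> j \in s -> i != j -> m (F i `&` F j) = 0%E) ->
  m (\big[setU/set0]_(j <- s) F j) = (\sum_(j <- s) m (F j))%E.
Proof.
move=> us mF; elim: s us => [|j s IH] /=; first by rewrite !big_nil measure0.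
case/andP => js us nul; rewrite !big_cons -IH//; last first.
  by move=> i k iS kS; apply: nul; rewrite inE ?iS ?kS orbT.
have mU : measurable (\big[setU/set0]_(k <- s) F k) by apply: bigsetU_measurable.
set U := \big[setU/set0]_(k <- s) F k in mU *.
have mI : m (F j `&` U) = 0%E.
  (* Measurability is carried along with nullity because [measureU0] asks for it at each union. *)
  have [mI nI] : measurable (F j `&` U) /\ m (F j `&` U) = 0%E; last by [].
  rewrite /U big_distrr /= big_seq.
  elim/big_ind: _ => [|A B [mA nA] [mB nB]|k kS]; first by split.
    by split; [exact: measurableU|rewrite measureU0].
  split; first exact: measurableI.
  by apply: nul; rewrite ?inE ?eqxx ?kS ?orbT//; apply: contraNneq js => ->.
rewrite [in RHS](measureDI m (mF j) mU) [X in (_ + X + _)%E]mI adde0 -measureU//.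
- by congr (m _); rewrite setDE setUIl setvU setIT.
- exact: measurableD.
- by apply/seteqP; split => x //= [[]].
Qed.

(** * Lipschitz curves in the network do not increase length *)

Section hat.
Context (R : realType) (Q : network R).

Definition hat (e : arcs Q) (c r : R) (z : netpoint Q) : R :=
  match z with
  | inl _ => 0
  | inr p => if (val p).1 == e then Num.max 0 (r - `|(val p).2 - c|) else 0
  end.

(** Since the support of the tent fits inside the arc, the formula vanishes at both ends, in
    agreement with the value 0 at nodes. *)
Lemma hat_arc_point e c r e' u : r <= c -> c + r <= len e -> 0 <= u <= len e' ->
  hat e c r (arc_point e' u) = if e' == e then Num.max 0 (r - `|u - c|) else 0.
Proof.
move=> rc cr hu; case: (arc_pointE hu) => [[-> ->]|[-> ->]|[h ->]] //=;
  case: eqP => // ee; apply/esym/max_idPl.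
- by rewrite sub0r normrN; have := ler_norm c; lra.
- by rewrite ee; have := ler_norm (len e - c); lra.
Qed.

Lemma hat_lipschitz e c r x y : r <= c -> c + r <= len e ->
  `|hat e c r x - hat e c r y| <= mdist x y.
Proof.
move=> rc cr; apply: (@lipschitz_path_dist R Q) => e' s t hs ht.
rewrite !hat_arc_point//; case: eqP => _; last by rewrite subrr normr0.
have : `| `|t - c| - `|s - c| | <= `|t - s|.
  by apply: le_trans (ler_dist_dist _ _) _; rewrite opprB addrA subrK.
have := normr_ge0 (t - s); rewrite !ler_norml.
by case: (ltP 0 (r - `|s - c|)) => ?; case: (ltP 0 (r - `|t - c|)) => ? ? /andP[? ?];
  apply/andP; split; lra.
Qed.

(* The coordinate along an arc is not 1-Lipschitz on Q, whose metric may take shortcuts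
   between the ends of the arc, but the tent function over the arc is; it is an
   isometry on each half of the arc. *)
Definition half (e : arcs Q) (k : bool) : set (netpoint Q) :=
  [set z | 0 < hat e (if k then 3 * (len e / 4) else len e / 4) (len e / 4) z].

(** The tent of radius [len e / 4] centred at one or three quarters of the arc is positive exactly
    on the corresponding open half. Preimages of halves under Lipschitz curves are therefore
    open. *)
Lemma halfP e k z : half e k z <->
  exists2 u, (if k then len e / 2 < u < len e else 0 < u < len e / 2) & z = arc_point e u.
Proof.
have l0 := len_gt0 e; pose c := if k then 3 * (len e / 4) else len e / 4.
have cr : len e / 4 <= c /\ c + len e / 4 <= len e by rewrite /c; case: (k); split; lra.
have P u : (0 < len e / 4 - `|u - c|) = (if k then len e / 2 < u < len e else 0 < u < len e / 2).
  rewrite subr_gt0 ltr_norml /c; case: (k); apply/andP/andP => -[? ?]; split; lra.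
split.
  rewrite /half /=; case: z => [v|[[e' u] h]] /=; first by rewrite ltxx.
  case: eqP h => [-> h|_ h]; last by rewrite ltxx.
  rewrite lt_max ltxx /= -/c P => hu; exists u => //.
  by rewrite (arc_point_val h).
case=> u hu ->; rewrite /half /= -/c hat_arc_point//; [|exact: cr.1|exact: cr.2|].
  by rewrite eqxx lt_max P hu orbT.
by case: (k) hu => /andP[? ?]; apply/andP; split; lra.
Qed.

Lemma arc_point_inj (e e' : arcs Q) u u' : 0 < u < len e -> arc_point e u = arc_point e' u' ->
  e = e' /\ u = u'.
Proof.
move=> hu; rewrite (arc_point_val hu) /arc_point; case: insubP => // -[[e2 u2] h2] _ /= [<- <-].
by case.
Qed.

Lemma half_disjoint e k e' k' z : half e k z -> half e' k' z -> (e, k) = (e', k').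
Proof.
move=> /halfP[u hu ->] /halfP[u' hu'] /arc_point_inj[].
  by have := len_gt0 e; case: (k) hu => /andP[? ?]; (move=> ?; apply/andP; split; lra).
move=> ee uu; subst e' u'; congr pair.
by case: k k' hu hu' => -[] // /andP[? ?] /andP[? ?]; exfalso; lra.
Qed.

Lemma lipschitz_continuous (f : R -> R) :
  (forall s t, `|f s - f t| <= `|s - t|) -> continuous f.
Proof.
move=> lf t; apply/cvgrPdist_lt => eps eps0.
by apply: filterS (nbhsx_ballx t eps eps0) => s; exact: le_lt_trans.
Qed.

(** Sort the times of [G] by the open half of an arc that [sigma] visits. On each half a tent
    composed with [sigma] reads off the coordinate, which reduces the claim to the real line. *)
Lemma length_measure_lipschitz_image (sigma : R -> netpoint Q) (G : set R) :
  (forall s t, mdist (sigma s) (sigma t) <= `|s - t|) -> measurable G ->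
  (length_measure (sigma @` G) <= lebesgue_measure G)%E.
Proof.
move=> ls mG; pose F (j : arcs Q * bool) : set R := G `&` sigma @^-1` half j.1 j.2.
have mF j : measurable (F j).
  apply: measurableI => //; apply: open_measurable.
  have -> : sigma @^-1` half j.1 j.2 =
    (fun t => hat j.1 (if j.2 then 3 * (len j.1 / 4) else len j.1 / 4) (len j.1 / 4) (sigma t))
     @^-1` `]0, +oo[%classic by apply/seteqP; split => t /=; rewrite in_itv /= andbT.
  apply: open_comp; last exact: interval_open.
  move=> t _; apply: lipschitz_continuous => s s'; apply: le_trans (ls _ _).
  by have l0 := len_gt0 j.1; apply: hat_lipschitz; case: ifP => _; lra.
apply: (@le_trans _ _ (\sum_(e : arcs Q) \sum_(k : bool) lebesgue_measure (F (e, k)))%E).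
  apply: lee_sum => e _; have l0 := len_gt0 e.
  pose f t := hat e (len e / 2) (len e / 2) (sigma t).
  have lf s t : `|f s - f t| <= `|s - t|.
    by apply: le_trans (ls _ _); apply: hat_lipschitz; lra.
  rewrite big_bool /=.
  (* Away from the midpoint, which is null, the coordinate is [f t] on the first half and
     [len e - f t] on the second. *)
  have ext : arc_point e @^-1` (sigma @` G) `&` `]0, len e[ `<=`
      [set len e / 2] `|` ((fun t => len e - f t) @` F (e, true) `|` f @` F (e, false)).
    move=> u [[t Gt tu]]; rewrite /= in_itv /= => /andP[u0 u1].
    have fE : f t = len e / 2 - `|u - len e / 2|.
      rewrite /f tu hat_arc_point ?eqxx; [|lra|lra|by rewrite !ltW].
      by apply/max_idPr; rewrite subr_ge0 ler_norml; apply/andP; split; lra.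
    have [h|h|h] := ltgtP u (len e / 2); last by left.
    - right; right; exists t.
        by split => //; apply/halfP; exists u => //; rewrite u0.
      by rewrite fE ltr0_norm ?subr_lt0//; lra.
    - right; left; exists t.
        by split => //; apply/halfP; exists u => //; rewrite h.
      by rewrite fE gtr0_norm ?subr_gt0//; lra.
  apply: (@le_trans _ _ _ _ _ (le_outer_measure lebesgue_measure _ _ ext)).
  apply: le_trans (outer_measureU2 _ _ _) _.
  rewrite [X in (X + _)%E](lebesgue_measure_set1 (len e / 2)) add0e.
  apply: le_trans (outer_measureU2 _ _ _) _.
  apply: leeD; apply: lebesgue_measure_lipschitz_image => // s t.
  by rewrite (_ : _ - _ = f t - f s) 1?distrC//; ring.
rewrite pair_bigA /=; under eq_bigr do rewrite -surjective_pairing.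
rewrite -measure_bigsetU_null//.
- apply: le_outer_measure; rewrite -bigcup_seq => t [j _ []] //.
- exact: index_enum_uniq.
- move=> i j _ _ ij; rewrite (_ : _ `&` _ = set0) ?measure0//.
  apply/seteqP; split => t // [[_ hi] [_ hj]]; move/eqP: ij; apply.
  by have := half_disjoint _ _ _ _ _ hi hj; rewrite -!surjective_pairing.
Qed.

End hat.

(** * Finiteness, subadditivity and positivity of length *)

Section length.
Context (R : realType) (Q : network R).

Lemma le_length_measure (A B : set (netpoint Q)) : A `<=` B ->
  (length_measure A <= length_measure B)%E.
Proof.
by move=> AB; apply: lee_sum => e _; apply: le_outer_measure => u [/AB].
Qed.

Lemma length_measure_setT :
  length_measure [set: netpoint Q] = (\sum_(e : arcs Q) len e)%:E.
Proof.
rewrite -sumEFin; apply: eq_bigr => e _; rewrite preimage_setT setTI.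
by rewrite lebesgue_measure_itv /= lte_fin len_gt0 -EFinD subr0.
Qed.

Lemma length_measure_fin_num (A : set (netpoint Q)) : length_measure A \is a fin_num.
Proof.
rewrite ge0_fin_numE ?measure_ge0//.
by apply: le_lt_trans (le_length_measure _ _ (@subsetT _ A)) _; rewrite length_measure_setT ltry.
Qed.

Lemma length_measure_bigcup_le (I : {fset netpoint Q}) (F : netpoint Q -> set (netpoint Q)) :
  (length_measure (\bigcup_(x in [set` I]) F x) <= \sum_(x <- I) length_measure (F x))%E.
Proof.
rewrite bigcup_fset; elim/big_ind2: _ => //; first by rewrite measure0.
move=> A a B b Aa Bb; apply: le_trans _ (leeD Aa Bb).
rewrite -big_split; apply: lee_sum => e _ /=.
by rewrite preimage_setU setIUl; exact: outer_measureU2.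
Qed.

(** A single node without arcs is a [network] of length 0. It has no covering path, so its
    [min_tour_length] is the [inf] of the empty set, that is 0, and [alpha] cannot lie below it. *)
Lemma length_measure_setT_gt0 (alpha : R) : 0 < alpha -> alpha < min_tour_length Q ->
  0 < fine (length_measure [set: netpoint Q]).
Proof.
move=> a0 alt; rewrite length_measure_setT /=.
have [e _] : exists e : arcs Q, True.
  apply: contrapT => noarc; move: alt; rewrite /min_tour_length; set E := (X in inf X).
  have -> : E = set0.
    apply/seteqP; split => // _ [p [cov _] <-].
    by have [e _] := cov point; apply: noarc; exists e.
  by rewrite inf0 ltNge ltW.
rewrite (bigD1 e) //=; apply: ltr_wpDr (len_gt0 e).
by apply: sumr_ge0 => e' _; apply/ltW/len_gt0.
Qed.

End length.

(** * The uniform law on [0, alpha] against Lebesgue measure *)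

Section uniform.
Context (R : realType) (alpha : R) (alpha_gt0 : 0 < alpha).

Lemma uniform_probI (U : set R) :
  uniform_prob alpha_gt0 U = uniform_prob alpha_gt0 (U `&` `[0, alpha]).
Proof. by rewrite /uniform_prob integral_uniform_pdf [RHS]integral_uniform_pdf -setIA setIid. Qed.

Lemma uniform_prob_sub (U : set R) : measurable U -> U `<=` `[0, alpha] ->
  lebesgue_measure U = (alpha%:E * uniform_prob alpha_gt0 U)%E.
Proof.
move=> mU Ua; rewrite /uniform_prob (eq_integral (cst (alpha^-1)%:E)); last first.
  by move=> t /set_mem /Ua; rewrite /= in_itv /= /uniform_pdf subr0 => ->.
by rewrite integral_cst// muleA -EFinM divff ?mul1e// gt_eqF.
Qed.

Lemma uniform_prob_null (U : set R) : measurable U -> lebesgue_measure U = 0%E ->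
  uniform_prob alpha_gt0 U = 0%E.
Proof. by have /null_content_dominatesP := dominates_uniform_prob alpha_gt0; exact. Qed.

End uniform.

(** * Interception probability of a fixed patrol *)

Section interception.
Context (R : realType) (Q : network R) (alpha : R) (alpha_gt0 : 0 < alpha).
Context (I : {fset netpoint Q}) (I_indep : independent alpha I) (S : patrol Q).

Definition hits (x : netpoint Q) : set R :=
  [set tau | intercepts alpha S (x, tau)] `&` `[0, alpha].

(** Every window starting in [0, alpha] contains the time [alpha]. Splitting by visits to [x] before
    or after that time gives two sets of start times, each an interval. *)
Lemma measurable_hits x : measurable (hits x).
Proof.
have -> : hits x =
    [set tau | 0 <= tau /\ exists2 z, tau <= z <= alpha & S z = x] `|`
    [set tau | tau <= alpha /\ exists2 z, alpha <= z <= tau + alpha & S z = x].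
  apply/seteqP; split => tau; rewrite /hits /= in_itv /=.
    move=> [[z [/andP[/= z1 z2] zx]] /andP[t0 t1]].
    have [za|az] := leP z alpha; [left|right]; split => //; exists z => //.
      by rewrite z1.
    by rewrite z2 ltW.
  by case=> -[t0 [z /andP[z1 z2] zx]]; (split; [exists z; split => //=|]);
    apply/andP; split; lra.
apply: measurableU; apply: is_interval_measurable => s t.
  move=> [s0 _] [_ [z /andP[z1 z2] zx]] u /andP[su ut]; split; first lra.
  by exists z => //; rewrite z2 andbT; lra.
move=> [_ [z /andP[z1 z2] zx]] [ta _] u /andP[su ut]; split; first lra.
by exists z => //; rewrite z1; lra.
Qed.

(* Points of I are alpha apart, so a window of length alpha meeting two of them
   meets them at its endpoints; there is at most one such window for each order. *)
Lemma hits_null x y : x \in I -> y \in I -> x != y ->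
  lebesgue_measure (hits x `&` hits y) = 0%E.
Proof.
move=> xI yI xy.
pose E (a b : netpoint Q) := [set tau | [/\ 0 <= tau <= alpha, S tau = a & S (tau + alpha) = b]].
have Enull a b : a \in I -> b \in I -> a != b -> (lebesgue_measure (E a b) <= 0)%E.
  move=> aI bI ab; have dab := I_indep _ _ aI bI ab.
  apply: lebesgue_measure_diam => // s t /set_mem[/andP[s0 s1] sa sb] /set_mem[/andP[t0 t1] ta tb].
  rewrite normr_le0 subr_eq0; apply/eqP/le_anti/andP; split; rewrite leNgt; apply/negP => st.
    (* Leaving [a] at the later start and reaching [b] at the earlier end would cover a distance of
       at least [alpha] in less than time [alpha]. *)
    have := @patrol_lipschitz _ _ S s (t + alpha); rewrite sa tb => /(_ s0).
    have t2 : 0 <= t + alpha by lra.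
    move=> /(_ t2) /(le_trans dab); rewrite ler_normr => /orP[]; lra.
  have := @patrol_lipschitz _ _ S t (s + alpha); rewrite ta sb => /(_ t0).
  have t2 : 0 <= s + alpha by lra.
  move=> /(_ t2) /(le_trans dab); rewrite ler_normr => /orP[]; lra.
apply/eqP; rewrite eq_le measure_ge0 andbT.
apply: (@le_trans _ _ (lebesgue_measure (E x y `|` E y x))).
  apply: le_outer_measure => tau [[[s [/andP[/= s1 s2] sx]]]].
  rewrite /= in_itv /= => /andP[t0 t1] [[t [/andP[/= t2 t3] ty]] _].
  have dxy := I_indep _ _ xI yI xy.
  have := @patrol_lipschitz _ _ S s t (le_trans t0 s1) (le_trans t0 t2).
  rewrite sx ty => /(le_trans dxy); rewrite ler_normr => /orP[] st.
    have es : s = tau + alpha by lra. have et : t = tau by lra.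
    by subst; right; split => //; rewrite t0.
  have es : t = tau + alpha by lra. have et : s = tau by lra.
  by subst; left; split => //; rewrite t0.
apply: le_trans (outer_measureU2 _ _ _) _; rewrite -[leRHS]adde0.
by apply: leeD; apply: Enull; rewrite // eq_sym.
Qed.

Definition misses : set R := `[0, alpha] `\` \big[setU/set0]_(x <- I) hits x.

Lemma measurable_misses : measurable misses.
Proof. by apply: measurableD => //; apply: bigsetU_measurable => x _; exact: measurable_hits. Qed.

(** Up to null overlaps, these sets are disjoint parts of [0, alpha], so their probabilities add up
    to that of the union. *)
Lemma hits_misses_le1 :
  (\sum_(x <- I) uniform_prob alpha_gt0 (hits x) + uniform_prob alpha_gt0 misses <= 1)%E.
Proof.
have mU : measurable (\big[setU/set0]_(x <- I) hits x).
  by apply: bigsetU_measurable => x _; exact: measurable_hits.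
rewrite -measure_bigsetU_null ?fset_uniq//; first last.
- move=> x y xI yI xy; apply: uniform_prob_null (hits_null _ _ xI yI xy).
  by apply: measurableI; exact: measurable_hits.
- exact: measurable_hits.
rewrite -measureU//; [|exact: measurable_misses|].
  apply: probability_le1; apply: measurableU => //; exact: measurable_misses.
by rewrite /misses setDE setICA setICr setI0.
Qed.

(* A point outside W seen at time t certifies that the window centred at t misses I. *)
Lemma far_intercepted :
  [set x | intercepts alpha S (x, alpha / 2)] `&` ~` nearby alpha I `<=`
  (fun t => S (Num.max 0 (t + alpha / 2))) @` misses.
Proof.
(* The witness is the start of the window centred at [t]; it lies in [0, alpha] because [t] lies in
   [alpha/2, 3 alpha/2]. *)
move=> _ [[t [/andP[/= t1 t2] <-]] far]; exists (t - alpha / 2); last first.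
  by rewrite subrK (max_idPr _)//; lra.
split; first by rewrite /= in_itv /=; apply/andP; split; lra.
rewrite -bigcup_fset => -[x xI [[s [/andP[/= s1 s2] sx]] _]]; apply: far.
exists x => //; rewrite -sx; have := @patrol_lipschitz _ _ S t s.
have h1 : 0 <= t by lra. have h2 : 0 <= s by lra.
move=> /(_ h1 h2) /le_trans; apply.
by rewrite ler_norml; apply/andP; split; lra.
Qed.

Lemma far_intercepted_le :
  (length_measure ([set x | intercepts alpha S (x, (alpha / 2)%R)] `&` ~` nearby alpha I)
   <= alpha%:E * uniform_prob alpha_gt0 misses)%E.
Proof.
apply: le_trans (le_length_measure _ _ _ _ far_intercepted) _.
rewrite -uniform_prob_sub; [|exact: measurable_misses|by move=> t []].
apply: length_measure_lipschitz_image; last exact: measurable_misses.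
(* Clamping at 0 is 1-Lipschitz and keeps the times where the patrol is Lipschitz, so the curve is
   1-Lipschitz on the whole line. *)
move=> s t; apply: le_trans (patrol_lipschitz _ _ _) _; rewrite ?le_max ?lexx//.
have := normr_ge0 (s - t); have := ler_norm (s - t); have := ler_norm (t - s).
rewrite (distrC t s) ler_norml.
by case: (ltP 0 (s + alpha / 2)) => ?; case: (ltP 0 (t + alpha / 2)) => ? ? ? ?;
  apply/andP; split; lra.
Qed.

Local Notation D := (far_length alpha I + #|` I|%:R * alpha).

Lemma independent_attack_le : 0 < D ->
  (independent_attack alpha_gt0 I (intercepts alpha S) <= (alpha / D)%:E)%E.
Proof.
move=> D0; have f0 := far_length_ge0 alpha I; have l0 : 0 <= #|` I|%:R :> R by [].
set A := (\sum_(x <- I) uniform_prob alpha_gt0 (hits x))%E.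
set B := uniform_prob alpha_gt0 misses.
have A0 : (0 <= A)%E by apply: sume_ge0 => x _; exact: measure_ge0.
have B0 : (0 <= B)%E by exact: measure_ge0.
have p1E : 1 - independent_attack_weight alpha I = far_length alpha I / D.
  by rewrite /independent_attack_weight; field; rewrite gt_eqF.
(* The two weights of the attack equal [alpha / D] and [D^-1], except when [l] or [far_length] is 0:
   the weight concerned is then 0, as [invr0] gives. *)
apply: (@le_trans _ _ ((alpha / D)%:E * A + (D^-1)%:E * (alpha%:E * B)))%E.
  apply: leeD.
    under eq_bigr do rewrite uniform_probI.
    apply: lee_wpmul2r => //; rewrite lee_fin /independent_attack_weight.
    have [ln0|ln0] := eqVneq (#|` I|%:R : R) 0.
      by apply: (@le_trans _ _ 0); [rewrite ln0 invr0 mulr0|rewrite divr_ge0 ?ltW].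
    by rewrite le_eqVlt; apply/orP; left; apply/eqP; field; rewrite ln0 gt_eqF.
  apply: le_trans (lee_wpmul2l _ far_intercepted_le).
    apply: lee_wpmul2r; first by rewrite measure_ge0.
    rewrite lee_fin p1E; have [fn0|fn0] := eqVneq (far_length alpha I) 0.
      by apply: (@le_trans _ _ 0); [rewrite fn0 invr0 mulr0|rewrite invr_ge0 ltW].
    by rewrite le_eqVlt; apply/orP; left; apply/eqP; field; rewrite fn0 gt_eqF.
  by rewrite lee_fin invr_ge0 ltW.
rewrite muleA -EFinM [(_^-1 * _)]mulrC -ge0_muleDr//.
rewrite -[leRHS]mule1; apply: lee_wpmul2l hits_misses_le1.
by rewrite lee_fin divr_ge0 ?ltW.
Qed.

End interception.

(** * The independent attack is a mixed strategy *)

Section attack.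
Context (R : realType) (Q : network R) (alpha : R) (alpha_gt0 : 0 < alpha).
Context (I : {fset netpoint Q}).
Local Notation D := (far_length alpha I + #|` I|%:R * alpha).

(** Either [I] has a point and the second term is positive, or nothing is nearby and [far_length] is
    the whole length of the network. *)
Lemma attack_denominator_gt0 : alpha < min_tour_length Q -> 0 < D.
Proof.
move=> alt; have mu0 := length_measure_setT_gt0 _ _ _ alpha_gt0 alt.
have f0 := far_length_ge0 alpha I.
have [I0|I0] := eqVneq I fset0; last first.
  by apply: ltr_wpDl => //; rewrite mulr_gt0// ltr0n cardfs_gt0.
rewrite I0 cardfs0 mul0r addr0 /far_length (_ : ~` _ = setT)//.
by apply/seteqP; split => // y _ [x]; rewrite in_fset0.
Qed.

Lemma independent_attack_mixed : 0 < D -> is_mixed_attack (independent_attack alpha_gt0 I).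
Proof.
move=> D0; split.
  rewrite /= /independent_attack (eq_bigr (fun=> 1%:E)); last first.
    by move=> x _; exact: (@probability_setT _ _ _ (uniform_prob alpha_gt0)).
  rewrite sumEFin big_const_seq count_predT iter_addr_0 -/(#|` I|).
  rewrite (_ : [set x | _] `&` _ = ~` nearby alpha I); last exact: setTI.
  rewrite -(fineK (length_measure_fin_num _ _ (~` nearby alpha I))) -/(far_length alpha I).
  rewrite -!EFinM -EFinD; congr EFin; rewrite /independent_attack_weight.
  have [fn0|fn0] := eqVneq (far_length alpha I) 0.
    (* Positivity of [D] forbids both terms to vanish, so one branch of the attack always carries
       mass. *)
    have ln0 : (#|` I|%:R : R) != 0.
      by apply/eqP => ln0; move: D0; rewrite fn0 ln0 mul0r addr0 ltxx.
    by rewrite fn0 invr0; field; rewrite ln0 gt_eqF.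
  have [ln0|ln0] := eqVneq (#|` I|%:R : R) 0.
    by rewrite ln0 !(mulr0, mul0r) add0r subr0 divfK.
  by rewrite !divfK// subrKC.
rewrite /= /independent_attack big1 ?mule0 ?add0e => [|x _].
  rewrite (_ : _ `&` _ = set0) ?measure0 ?mule0//.
  by apply/seteqP; split => // x [/=]; rewrite ltNge divr_ge0 ?ltW.
rewrite uniform_probI (_ : _ `&` _ = set0) ?measure0//.
by apply/seteqP; split => // t [/=]; rewrite in_itv /= => ? /andP[? ?]; lra.
Qed.

End attack.

(** * Balls around leaf nodes *)

Section leaf.
Context (R : realType) (Q : network R).

(** As a loop counts twice, degree 1 leaves one incidence in all; the inequality of booleans says
    that exactly one end of [e] is [v]. *)
Lemma leaf_unique_arc (v : nodes Q) : is_leaf v -> exists e : arcs Q,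
  [/\ (src e == v) != (tgt e == v) & forall e', e' != e -> src e' != v /\ tgt e' != v].
Proof.
rewrite /is_leaf /degree /mdegree.
case hs: #|[pred e | src e == v]| => [|[|n]]; case ht: #|[pred e | tgt e == v]| => [|[|m]] // _.
- have [e he] := mem_card1 ht; have h0 := card0_eq hs; exists e; split.
    by have := h0 e; have := he e; rewrite !inE eqxx => -> ->.
  by move=> e' ne; have := h0 e'; have := he e'; rewrite !inE (negbTE ne) => -> ->.
- have [e he] := mem_card1 hs; have h0 := card0_eq ht; exists e; split.
    by have := h0 e; have := he e; rewrite !inE eqxx => -> ->.
  by move=> e' ne; have := h0 e'; have := he e'; rewrite !inE (negbTE ne) => -> ->.
Qed.

(* Around a leaf, the distance to the leaf dominates the coordinate along its arc. *)
Lemma length_measure_leaf_ball (v : nodes Q) (r : R) : 0 <= r -> is_leaf v ->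
  (forall e : arcs Q, leaf_arc e -> r < len e) ->
  (length_measure [set y | (mdist y (node_point v) <= r)%R] <= r%:E)%E.
Proof.
move=> r0 lv rlen; have [e [ev ne]] := leaf_unique_arc _ lv.
have re : r < len e.
  apply: rlen; move: ev; rewrite /leaf_arc.
  case: (eqVneq (src e) v) => [->|_]; first by rewrite lv.
  by case: (eqVneq (tgt e) v) => [->|//]; rewrite lv orbT.
have l0 := len_gt0 e.
pose g u := if src e == v then u else len e - u.
(* [f] is the coordinate from the leaf on [e], frozen at [len e] beyond it. As [r < len e], the set
   where [f] is at most [r] meets no other arc. *)
pose f (z : netpoint Q) : R := match z with
  | inl w => if w == v then 0 else len e
  | inr p => if (val p).1 == e then g (val p).2 else len e
  end.
have fE u : 0 <= u <= len e -> f (arc_point e u) = g u.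
  case/arc_pointE => [[-> ->]|[-> ->]|[h ->]] /=; rewrite /g ?eqxx//; move: ev;
  case: (src e == v); case: (tgt e == v) => //; rewrite ?subr0 ?subrr//.
have fE' e' u : e' != e -> 0 <= u <= len e' -> f (arc_point e' u) = len e.
  move=> ee /arc_pointE; have [/negbTE h1 /negbTE h2] := ne _ ee.
  by case=> [[_ ->]|[_ ->]|[h ->]] /=; rewrite ?h1 ?h2 ?(negbTE ee).
have fle y : mdist y (node_point v) <= r -> f y <= r.
  apply: le_trans; have -> : f y = f y - f (node_point v) by rewrite /= eqxx subr0.
  apply: le_trans (ler_norm _) _; apply: (@lipschitz_path_dist R Q) => e' s t hs ht.
  have [ee|ee] := eqVneq e' e; last by rewrite !fE'// subrr normr0.
  subst e'; rewrite !fE// /g; case: ifP => _; first by rewrite distrC.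
  by rewrite (_ : _ - _ = t - s)//; ring.
rewrite /length_measure (bigD1 e) //= big1 ?adde0 => [|e' ee]; last first.
  rewrite (_ : _ `&` _ = set0) ?measure0//; apply/seteqP; split => // u [/= /fle].
  rewrite in_itv /= => h /andP[u0 u1]; move: h; rewrite fE' ?(ltW u0) ?(ltW u1)//; lra.
apply: lebesgue_measure_diam => // s t /set_mem[/fle + +] /set_mem[/fle + +].
rewrite /= !in_itv /= => hs /andP[s0 s1] ht /andP[t0 t1]; move: hs ht.
rewrite !fE ?(ltW s0) ?(ltW s1) ?(ltW t0) ?(ltW t1)// /g ler_norml.
by case: ifP => _ ? ?; apply/andP; split; lra.
Qed.

(** The nearby set is a union of [l] balls, each of length at most [alpha / 2]. *)
Lemma far_length_leaves (alpha : R) (I : {fset netpoint Q}) : 0 < alpha ->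
  (forall x, x \in I -> exists2 v : nodes Q, is_leaf v & x = node_point v) ->
  (forall e : arcs Q, leaf_arc e -> alpha / 2 < len e) ->
  fine (length_measure [set: netpoint Q]) <= far_length alpha I + #|` I|%:R * (alpha / 2).
Proof.
move=> a0 leaves hlen; rewrite -lee_fin fineK ?length_measure_fin_num// EFinD.
have mWc : measurable (~` nearby alpha I) by apply: open_point_measurable; exact: open_far.
have mW : measurable (nearby alpha I) by rewrite -[nearby _ _]setCK; exact: measurableC.
rewrite /far_length fineK ?length_measure_fin_num// -(setvU (nearby alpha I)).
rewrite measureU ?setICl//.
apply: leeD2l.
have -> : nearby alpha I = \bigcup_(x in [set` I]) [set y | mdist y x <= alpha / 2].
  by apply/seteqP; split => y [x]; exists x.
apply: le_trans (length_measure_bigcup_le _ _ _ _) _.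
apply: (@le_trans _ _ (\sum_(x <- I) (alpha / 2)%:E)%E).
  rewrite big_seq [leRHS]big_seq; apply: lee_sum => x /leaves[v lv ->].
  by apply: length_measure_leaf_ball => //; rewrite divr_ge0 ?ltW.
by rewrite sumEFin big_const_seq count_predT iter_addr_0 lee_fin mulr_natl.
Qed.

End leaf.

Theorem theorem1 (R : realType) (Q : network R) (alpha : R)
    (alpha_gt0 : 0 < alpha) (alpha_lt : alpha < min_tour_length Q)
    (I : {fset netpoint Q}) (I_indep : independent alpha I) :
  let l : R := #|` I|%:R in
  let lambda := @length_measure R Q in
  let Wc := ~` nearby alpha I in
  let bound := alpha / (fine (lambda Wc) + l * alpha) in
  [/\ is_mixed_attack (independent_attack alpha_gt0 I),
      (forall S : patrol Q,
        (independent_attack alpha_gt0 I (intercepts alpha S) <= bound%:E)%E) &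
      forall V : R, is_value Q alpha V ->
        [/\ V <= bound,
            lambda Wc = 0%E -> V <= 1 / l &
            (forall x, (x \in I) <-> (exists2 v : nodes Q, is_leaf v & x = node_point v)) ->
            (forall e : arcs Q, leaf_arc e -> alpha / 2 < len e) ->
            V <= alpha / (fine (lambda setT) + l * alpha / 2)]].
Proof.
move=> l lambda Wc bound.
have D0 : 0 < fine (lambda Wc) + l * alpha by exact: attack_denominator_gt0.
have mixed := independent_attack_mixed _ _ _ alpha_gt0 I D0.
have guarantee S := independent_attack_le _ _ _ alpha_gt0 I I_indep S D0.
split=> // V [_ upper].
have Vbound : V <= bound.
  (* The value is an infimum over mixed attacks, one of which is the independent attack. *)
  rewrite -lee_fin -upper; apply: ge_ereal_inf.
  exists (ereal_sup [set independent_attack alpha_gt0 I (intercepts alpha S) | S in setT]).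
    by exists (independent_attack alpha_gt0 I).
  by apply: ge_ereal_sup => _ [S _ <-].
split=> // [Wc0|leaves hlen].
  by rewrite (le_trans Vbound)// /bound Wc0 add0r invfM mulrCA divff ?gt_eqF// mulr1 div1r.
have mu0 : 0 < fine (lambda setT) := length_measure_setT_gt0 _ _ _ alpha_gt0 alpha_lt.
have l0 : 0 <= l * alpha by rewrite mulr_ge0// ltW.
have hmu : fine (lambda setT) <= fine (lambda Wc) + l * (alpha / 2).
  by apply: far_length_leaves => // x /leaves.
(* Adding [l * alpha / 2] to both sides of [hmu] compares the two denominators. *)
rewrite (le_trans Vbound)// ler_pM2l// lef_pV2 ?posrE//; last by lra.
by move: hmu; rewrite mulrA; lra.
Qed.
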